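(* Let $\widehat{A}=A+\varepsilon B$ be an $n\times n$ dual matrix with $A,B\in\mathbb{R}^{n\times n}$. If the dual group generalized inverse $\widehat{A}^{\#}$ exists and $\widehat{A}^{\#}=A^{\#}-\varepsilon A^{\#}BA^{\#}$, then the dual core generalized inverse $\widehat{A}^{\mathrm{c}}$ exists and $\widehat{A}^{\mathrm{c}}=A^{\mathrm{c}}-\varepsilon A^{\mathrm{c}}BA^{\mathrm{c}}$.
   Context: Dual numbers are $a+\varepsilon a'$ with $a,a'\in\mathbb{R}$ and $\varepsilon\neq 0$, $\varepsilon^2=0$ (i.e. the ring $\mathbb{R}[\varepsilon]/(\varepsilon^2)$). A dual matrix is a matrix over dual numbers, written $\widehat{A}=A+\varepsilon B$ with $A,B$ real; its transpose is $\widehat{A}^{T}=A^{T}+\varepsilon B^{T}$. For an $n\times n$ dual matrix $\widehat{A}$ (each inverse below is unique when it exists): the dual group generalized inverse (DGGI) $\widehat{A}^{\#}$ is the $\widehat{G}$ with $\widehat{A}\widehat{G}\widehat{A}=\widehat{A}$, $\widehat{G}\widehat{A}\widehat{G}=\widehat{G}$, $\widehat{A}\widehat{G}=\widehat{G}\widehat{A}$; the dual core generalized inverse (DCGI) $\widehat{A}^{\mathrm{c}}$ is the $\widehat{G}$ with $\widehat{A}\widehat{G}\widehat{A}=\widehat{A}$, $\widehat{A}\widehat{G}^2=\widehat{G}$, $(\widehat{A}\widehat{G})^{T}=\widehat{A}\widehat{G}$. For a real square matrix $A$ the group inverse $A^{\#}$ and the core inverse $A^{\mathrm{c}}$ are the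 real matrices defined by the same respective equations (both exist exactly when $\mathrm{rank}(A^2)=\mathrm{rank}(A)$, which holds whenever $\widehat{A}^{\#}$ exists). *)

(* Defs.v *)
From mathcomp Require Import all_boot all_order all_algebra.
From mathcomp Require Import reals.

Set Implicit Arguments.
Unset Strict Implicit.
Unset Printing Implicit Defensive.

Import GRing.Theory.
Local Open Scope ring_scope.

(* [{poly %/ h}] is the quotient by [mk_monic h]; [mk_monic_Xn] shows that
   this is the quotient by h itself for h = 'X^2. *)
Notation dual R := {poly %/ ('X^2 : {poly R})}.

Definition deps (R : realType) : dual R := 'qX.

Definition dconst (R : realType) (a : R) : dual R := qpolyC 'X^2 a.

Definition dualmx (R : realType) (m n : nat) (A B : 'M[R]_(m, n)) :
    'M[dual R]_(m, n) :=
  map_mx (@dconst R) A + deps R *: map_mx (@dconst R) B.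

Definition is_group_inverse (K : comNzRingType) (n : nat) (A G : 'M[K]_n) :=
  [/\ A *m G *m A = A, G *m A *m G = G & A *m G = G *m A].

Definition is_core_inverse (K : comNzRingType) (n : nat) (A G : 'M[K]_n) :=
  [/\ A *m G *m A = A, A *m (G *m G) = G & (A *m G)^T = A *m G].

Section DualFacts.
Variable R : realType.

Lemma mk_monic_X2 : mk_monic ('X^2 : {poly R}) = 'X^2.
Proof. by rewrite mk_monic_Xn. Qed.

Lemma depsE : deps R = 'X :> {poly R}.
Proof. by rewrite qpolyXE ?size_polyXn ?monicXn. Qed.

Lemma deps_sqr : deps R * deps R = 0.
Proof.
have e : deps R * deps R = 0 :> {poly R}.
  rewrite poly_of_qpolyM depsE mk_monic_X2 -expr2.
  exact: Pdiv.RingMonic.rmodpp (monicXn _ _).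
by apply: val_inj; exact: e.
Qed.

Lemma dualE (a b : R) :
  dconst a + deps R * dconst b = a%:P + b *: 'X :> {poly R}.
Proof.
rewrite poly_of_qpolyD poly_of_qpolyM /dconst !qpolyCE depsE mk_monic_X2.
rewrite mulrC mul_polyC Pdiv.CommonRing.rmodp_small //.
by rewrite size_polyXn (leq_ltn_trans (size_scale_leq _ _)) // size_polyX.
Qed.

Lemma dual_inj (a b c d : R) :
  dconst a + deps R * dconst b = dconst c + deps R * dconst d ->
  a = c /\ b = d.
Proof.
move=> /(congr1 (@polyn _ _)); rewrite !dualE => e; split.
  have := congr1 (fun p : {poly R} => p`_0) e.
  by rewrite !coefD !coefZ !coefX !coefC /= !mulr0 !addr0.
have := congr1 (fun p : {poly R} => p`_1) e.
by rewrite !coefD !coefZ !coefX !coefC /= !mulr1 !add0r.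
Qed.

Lemma dual_surj (x : dual R) :
  exists a b : R, x = dconst a + deps R * dconst b.
Proof.
exists (polyn x)`_0, (polyn x)`_1; apply: val_inj; apply/esym.
have sx : (size (polyn x) <= 2)%N.
  by have := size_mk_monic x; rewrite [in X in (_ < X)%N]mk_monic_X2 size_polyXn.
apply: etrans (dualE _ _) _.
apply/polyP => -[|[|i]]; rewrite coefD coefZ coefX coefC /=.
- by rewrite mulr0 addr0.
- by rewrite mulr1 add0r.
- by rewrite mulr0 addr0 nth_default // (leq_trans sx).
Qed.

Lemma tr_dualmx m n (A B : 'M[R]_(m, n)) : (dualmx A B)^T = dualmx A^T B^T.
Proof. by apply/matrixP=> i j; rewrite !mxE. Qed.

End DualFacts.

(* Main.v *)
(** Write [E = A A^#] and let [A^] be the dual matrix [A + eps B]. The dual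
    part of [A^ G = G A^] is [(1 - E) B A^# = A^# B (1 - E)]; both sides vanish,
    as [E] kills the left one and fixes the right one. Hence the dual part of
    [A^ G A^ = A^] reduces to [E B = B], so the range of [B] lies in that
    of [A]. If [P] is the orthogonal projector onto the range of [A], then
    [A^# P] is the core inverse of [A], and [P B = B] makes the dual part
    of [A^ C] vanish: [A^ C = P], and the core equations for [C] reduce to
    real ones. *)
Require Import Defs.
From mathcomp Require Import all_boot all_order all_algebra.
From mathcomp Require Import reals.

Import GRing.Theory.
Local Open Scope ring_scope.

(** Each diagonal entry of [A^T *m A] is the sum of the squares of a column of [A], so every square
    vanishes. *)
Lemma trmx_mul_eq0 (F : realDomainType) m n (A : 'M[F]_(m, n)) :
  A^T *m A = 0 -> A = 0.
Proof.
move=> AA0; apply/matrixP => i j; rewrite mxE.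
have /eqP := congr1 (fun M : 'M_n => M j j) AA0.
rewrite !mxE Num.Theory.psumr_eq0 => [/allP /(_ i)|k _]; last first.
  by rewrite mxE -expr2 Num.Theory.sqr_ge0.
by rewrite mem_index_enum => /(_ isT) /=; rewrite mxE mulf_eq0 orbb => /eqP.
Qed.

(** With [K] the cokernel of [A^T *m A], one has [(A *m K)^T *m (A *m K) = 0], hence
    [A *m K = 0]. *)
Lemma submx_trmx_mul (F : realFieldType) m n (A : 'M[F]_(m, n)) :
  (A <= A^T *m A)%MS.
Proof.
rewrite submxE; apply/eqP/trmx_mul_eq0.
by rewrite trmx_mul -mulmxA (mulmxA A^T) mulmx_coker mulmx0.
Qed.

(** Writing [A = Y *m A^T *m A], take [P = Y *m A^T]. Then [P^T = A *m Y^T] is fixed by [P], so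
    [P^T = P *m P^T] is symmetric; hence [P = P^T] and [X = Y^T] works. *)
Lemma orthogonal_projector (F : realFieldType) m n (A : 'M[F]_(m, n)) :
  exists P X, [/\ P^T = P, P *m A = A & P = A *m X].
Proof.
have /submxP[Y AE] := submx_trmx_mul _ _ _ A.
have PA : Y *m A^T *m A = A by rewrite -mulmxA -AE.
have PT : (Y *m A^T)^T = Y *m A^T.
  have PTE : (Y *m A^T)^T = A *m Y^T by rewrite trmx_mul trmxK.
  have PP : (Y *m A^T) *m (Y *m A^T)^T = (Y *m A^T)^T by rewrite PTE mulmxA PA.
  move: (Y *m A^T) PP => P PP.
  by rewrite -[RHS]trmxK -PP trmx_mul trmxK.
exists (Y *m A^T); exists Y^T; split=> //.
by rewrite -PT trmx_mul trmxK.
Qed.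

Lemma dualmx_mul (R : realType) m n p (A B : 'M[R]_(m, n)) (C D : 'M_(n, p)) :
  dualmx A B *m dualmx C D = dualmx (A *m C) (A *m D + B *m C).
Proof.
(* [dconst] unfolds to the ring morphism [qpolyC 'X^2]. *)
have dconst_map k l q (M : 'M[R]_(k, l)) (N : 'M_(l, q)) :
    map_mx (@dconst R) (M *m N) = map_mx (@dconst R) M *m map_mx (@dconst R) N.
  exact: (map_mxM (qpolyC 'X^2)).
have dconstD k l (M N : 'M[R]_(k, l)) :
    map_mx (@dconst R) (M + N) = map_mx (@dconst R) M + map_mx (@dconst R) N.
  exact: (map_mxD (qpolyC 'X^2)).
rewrite /dualmx dconstD !dconst_map mulmxDl !mulmxDr.
rewrite -!scalemxAl -!scalemxAr scalerA deps_sqr scale0r addr0.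
by rewrite scalerDr addrA.
Qed.

Lemma dualmx_mul3 (R : realType) m n p q
    (A B : 'M[R]_(m, n)) (C D : 'M_(n, p)) (E F : 'M_(p, q)) :
  dualmx A B *m dualmx C D *m dualmx E F =
  dualmx (A *m C *m E) (A *m C *m F + (A *m D + B *m C) *m E).
Proof.
exact: etrans (congr1 (mulmx^~ _) (dualmx_mul _ _ _ _ _ _ _ _))
              (dualmx_mul _ _ _ _ _ _ _ _).
Qed.

Lemma dualmx_inj (R : realType) m n (A B C D : 'M[R]_(m, n)) :
  dualmx A B = dualmx C D -> A = C /\ B = D.
Proof.
move=> /matrixP ABCD.
have e i j : A i j = C i j /\ B i j = D i j.
  by apply: dual_inj; have := ABCD i j; rewrite !mxE.
by split; apply/matrixP => i j; have [] := e i j.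
Qed.

Lemma dual_group_inverse_corner (R : realType) n (A B G : 'M[R]_n) :
    is_group_inverse A G ->
    is_group_inverse (dualmx A B) (dualmx G (- (G *m B *m G))) ->
  A *m G *m B = B.
Proof.
case=> AGA GAG AG [dAGA _ dAG].
(* Explicit [etrans] chains: [rewrite dualmx_mul] would try to unify products
   over [dual R] with products over [R], which unfolds [dual R] at great cost. *)
have [_ B1] := dualmx_inj _ _ _ _ _ _ _
  (etrans (esym (dualmx_mul3 _ _ _ _ _ _ _ _ _ _ _)) dAGA).
have [_ B2] := dualmx_inj _ _ _ _ _ _ _
  (etrans (etrans (esym (dualmx_mul _ _ _ _ _ _ _ _)) dAG)
          (dualmx_mul _ _ _ _ _ _ _ _)).
have EG : A *m G *m G = G by rewrite AG.
move: B1 B2; rewrite !mulmxN !mulNmx !mulmxA => B1 B2.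
(* Left multiplication by [A *m G], idempotent and fixing [G], isolates the right side of [B2] and
   shows that it is zero. *)
have {B2} B2 : B *m G = A *m G *m B *m G.
  have := congr1 (mulmx (A *m G)) B2.
  rewrite !mulmxDr !mulmxN !mulmxA AGA addNr EG => B3.
  by move: B2; rewrite -B3 addrC => /eqP; rewrite subr_eq0 => /eqP.
by move: B1; rewrite mulmxDl mulNmx B2 addNr addr0.
Qed.

Theorem theorem3p14 (R : realType) (n : nat) (A B Ag : 'M[R]_n)
    (G : 'M[dual R]_n)
    (hAg : is_group_inverse A Ag)
    (hG : is_group_inverse (dualmx A B) G)
    (hGE : G = dualmx Ag (- (Ag *m B *m Ag))) :
  exists (Ac : 'M[R]_n) (C : 'M[dual R]_n),
    [/\ is_core_inverse A Ac,
        is_core_inverse (dualmx A B) C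
      & C = dualmx Ac (- (Ac *m B *m Ac))].
Proof.
subst G; have EB := dual_group_inverse_corner _ _ _ _ _ hAg hG.
case: hAg => AGA GAG AG.
have [P [X [PT PA PE]]] := orthogonal_projector _ _ _ A.
have PB : P *m B = B by rewrite -EB !mulmxA PA.
have PG : P *m Ag = Ag by rewrite -GAG -AG !mulmxA PA.
have AC : A *m (Ag *m P) = P by rewrite PE !mulmxA AGA.
have PC : P *m (Ag *m P) = Ag *m P by rewrite mulmxA PG.
(* From here on, [A *m C0 = P] and [P *m C0 = C0] are all that is used of [Ag *m P]. *)
move: (Ag *m P) AC PC => C0 AC PC; set C1 := - (C0 *m B *m C0).
have dAC : dualmx A B *m dualmx C0 C1 = dualmx P 0.
  by rewrite dualmx_mul AC mulmxN !mulmxA AC PB addNr.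
exists C0; exists (dualmx C0 C1); split; [split | split | reflexivity].
- by rewrite AC.
- by rewrite mulmxA AC.
- by rewrite AC.
- apply: etrans (congr1 (mulmx^~ _) dAC) _.
  apply: etrans (dualmx_mul _ _ _ _ _ _ _ _) _.
  by congr dualmx; rewrite // mul0mx addr0.
- apply: etrans (mulmxA _ _ _) _; apply: etrans (congr1 (mulmx^~ _) dAC) _.
  apply: etrans (dualmx_mul _ _ _ _ _ _ _ _) _.
  by congr dualmx; rewrite // mul0mx addr0 mulmxN !mulmxA PC.
- apply: etrans (congr1 trmx dAC) (etrans _ (esym dAC)).
  by apply: etrans (tr_dualmx _ _) _; congr dualmx; rewrite // trmx0.
Qed.
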